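(* Let $q$ be a complex number with $|q|<1$ and let $k\geqslant 1$ be an integer. Then $$\frac{(-q;q^2)_\infty}{(q^2;q^2)_\infty} \sum_{j=0}^{k-1}(-1)^jq^{j(2j+1)}(1-q^{2j+1}) =1+(-1)^{k-1} \sum_{n=k}^\infty \frac{(-q;q^2)_{k}\, (-q;q^2)_{n-k}\,q^{2(k+1)n-k}} {(q^2;q^2)_n}{n-1\brack k-1}_{q^2}.$$
   Context: For a base $x$ with $|x|<1$, the shifted factorials are $(a;x)_\infty=\prod_{n=0}^{\infty}(1-ax^n)$ and, for integers $M\geqslant 0$, $(a;x)_M=\dfrac{(a;x)_\infty}{(ax^M;x)_\infty}=\prod_{i=0}^{M-1}(1-ax^i)$. The Gaussian binomial coefficient with base $x$ is, for integers $0\leqslant N\leqslant M$, ${M\brack N}_x=\dfrac{(x;x)_M}{(x;x)_N (x;x)_{M-N}}$. In the claim the base is $x=q^2$. *)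

(* Defs.v *)
From Stdlib Require Import Reals Lra Lia.
From Coquelicot Require Export Coquelicot.

Open Scope C_scope.

(** [qpoch a x M] is (a;x)_M, the product of [1 - a x^i] for [0 <= i < M]. *)
Fixpoint qpoch (a x : C) (M : nat) : C :=
  match M with
  | O => 1
  | S i => qpoch a x i * (1 - a * x ^ i)
  end.

(** (a;x)_oo.  [lim] is a total operator; [qpoch_inf_correct] below shows that
    the product does converge to this value whenever [|x| < 1]. *)
Definition qpoch_inf (a x : C) : C :=
  @lim C_CompleteNormedModule (filtermap (qpoch a x) eventually).

(** Only meaningful for [N <= M], because of the truncated [M - N]. *)
Definition qbinom (x : C) (M N : nat) : C :=
  qpoch x x M / (qpoch x x N * qpoch x x (M - N)).

Lemma qpoch_bound (a x : C) (M : nat) :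
  (Cmod x < 1)%R ->
  (Cmod (qpoch a x M) <= exp (Cmod a / (1 - Cmod x)))%R.
Proof.
intros Hx.
assert (H0 := Cmod_ge_0 a). assert (H1 := Cmod_ge_0 x).
apply Rle_trans with
  (exp (Cmod a * ((1 - Cmod x ^ M) / (1 - Cmod x))))%R.
- induction M as [|M IH]; simpl qpoch.
  + rewrite Cmod_1. simpl.
    replace (Cmod a * ((1 - 1) / (1 - Cmod x)))%R with 0%R by (field; lra).
    rewrite exp_0; lra.
  + rewrite Cmod_mult.
    replace (Cmod a * ((1 - Cmod x ^ S M) / (1 - Cmod x)))%R
      with (Cmod a * ((1 - Cmod x ^ M) / (1 - Cmod x)) + Cmod a * Cmod x ^ M)%R
      by (simpl; field; lra).
    rewrite exp_plus.
    apply Rmult_le_compat; try apply Cmod_ge_0; [exact IH|].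
    apply Rle_trans with (1 + Cmod a * Cmod x ^ M)%R; [|apply exp_ineq1_le].
    eapply Rle_trans; [apply Cmod_triangle|].
    rewrite Cmod_1, Cmod_opp, Cmod_mult, Cmod_pow. lra.
- assert (Hle : (Cmod a * ((1 - Cmod x ^ M) / (1 - Cmod x))
                 <= Cmod a / (1 - Cmod x))%R).
  { apply Rmult_le_compat_l; [exact H0|].
    rewrite <- (Rmult_1_l (/ (1 - Cmod x))).
    apply Rmult_le_compat_r.
    - left; apply Rinv_0_lt_compat; lra.
    - assert (H2 := pow_le _ M H1); lra. }
  destruct Hle as [Hlt|Heq]; [left; apply exp_increasing; exact Hlt|].
  rewrite Heq; lra.
Qed.

Lemma qpoch_inf_correct (a x : C) :
  (Cmod x < 1)%R -> filterlim (qpoch a x) eventually (locally (qpoch_inf a x)).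
Proof.
intros Hx.
assert (H1 := Cmod_ge_0 x).
set (B := exp (Cmod a / (1 - Cmod x))).
set (d := fun n : nat => (qpoch a x (S n) - qpoch a x n : C)).
assert (Hd : ex_series (d : nat -> C_CompleteNormedModule)).
{ apply ex_series_le with (fun n : nat => scal (B * Cmod a)%R (Cmod x ^ n)%R).
  - intros n. unfold d. change (norm ?z) with (Cmod z). simpl qpoch.
    replace (qpoch a x n * (1 - a * x ^ n) - qpoch a x n)
      with (- (qpoch a x n * (a * x ^ n))) by ring.
    rewrite Cmod_opp, !Cmod_mult, Cmod_pow.
    change (scal ?u ?v) with (u * v)%R. rewrite Rmult_assoc.
    apply Rmult_le_compat_r; [|apply qpoch_bound; exact Hx].
    apply Rmult_le_pos; [apply Cmod_ge_0|apply pow_le; exact H1].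
  - apply (ex_series_scal (V := R_NormedModule)).
    apply ex_series_geom. rewrite Rabs_pos_eq; lra. }
destruct Hd as [l Hl].
apply (filterlim_locally (U := C_CompleteNormedModule)). intros eps.
refine (complete_cauchy (T := C_CompleteNormedModule)
          (filtermap (qpoch a x) eventually) _ _ eps).
intros e. exists (plus l (1 : C)).
assert (Hs : forall n, plus (sum_n d n) (1 : C) = qpoch a x (S n)).
{ induction n as [|n IH].
  - rewrite sum_O.
    change (qpoch a x 1 - qpoch a x 0 + 1 = qpoch a x 1). simpl. ring.
  - rewrite sum_Sn.
    transitivity (qpoch a x (S n) + d (S n)).
    + rewrite <- IH.
      change (sum_n d n + d (S n) + 1 = sum_n d n + 1 + d (S n)). ring.
    + change (qpoch a x (S n) + (qpoch a x (S (S n)) - qpoch a x (S n))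
              = qpoch a x (S (S n))). ring. }
assert (Hp : filterlim (fun n => plus (sum_n d n) (1 : C)) eventually
               (locally (plus l (1 : C)))).
{ refine (filterlim_comp_2 (F := eventually) (G := locally l)
            (H := locally (1 : C)) _ _ _ Hl (filterlim_const _) _).
  apply (filterlim_plus (V := C_CompleteNormedModule)). }
destruct (proj1 (filterlim_locally (U := C_CompleteNormedModule) _ _) Hp e)
  as [N HN].
exists (S N). intros [|n] Hn; [lia|].
rewrite <- Hs. apply HN. lia.
Qed.

(* Main.v *)
Require Import Defs.
From Stdlib Require Import Reals Lra Lia.
From Coquelicot Require Import Coquelicot.
Open Scope C_scope.

(** Put x = q^2, a = -q and P = (a;x)_oo / (x;x)_oo, and let
    A_j = sum_m (a;x)_m x^(j m) / (x;x)_m and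
    F_(k,j) = sum_m (a;x)_m x^(j m) / ((x;x)_m (1 - x^(k+m))).
    The series of the theorem is
    S_k = (a;x)_k q^(k(2k+1)) / (x;x)_(k-1) F_(k,k+1).
    Termwise, F_(k,j) - x^k F_(k,j+1) = A_j and
    A_j = 1 + x^j (F_(1,j) - a F_(1,j+1)), hence
    (1 - x^j) A_j = (1 - a x^j) A_(j+1); as A_j tends to 1, this gives the
    q-binomial theorem (a;x)_(j+1) A_(j+1) = P (x;x)_j.  Iterating the first
    relation in j yields a contiguous relation between F_(k,k+1) and
    F_(k+1,k+2) which says S_k + S_(k+1) = P q^(k(2k+1)) (1 - q^(2k+1)),
    and the theorem follows by induction on k. *)

(** * Power series with bounded coefficients inside the unit disc *)

Definition bounded_coef (c : nat -> C) : Prop :=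
  exists B : R, forall m, (Cmod (c m) <= B)%R.

(** [iota] makes the sum a total function of [z]; its value is meaningful only where the series
    converges, as in [power_sum_correct]. *)
Definition power_sum (c : nat -> C) (z : C) : C :=
  iota (fun l : C_CompleteNormedModule =>
          is_series (V := C_CompleteNormedModule) (fun m => c m * z ^ m) l).

Lemma is_series_C_unique (u : nat -> C) (l1 l2 : C) :
  is_series u l1 -> is_series u l2 -> l1 = l2.
Proof.
intros H1 H2.
exact (filterlim_locally_unique (V := C_NormedModule) (F := eventually)
         _ _ _ H1 H2).
Qed.

Lemma is_lim_C_geom (u : nat -> C) (l : C) (M r : R) :
  (0 <= r < 1)%R -> (forall n, (Cmod (u n - l) <= M * r ^ n)%R) ->
  filterlim u eventually (locally l).
Proof.
intros Hr Hu.
apply (filterlim_locally_ball_norm (U := C_NormedModule)). intros eps.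
assert (Hl : is_lim_seq (fun n => M * r ^ n)%R 0).
{ replace (Finite 0) with (Rbar_mult M 0) by (simpl; f_equal; ring).
  apply is_lim_seq_scal_l, is_lim_seq_geom. rewrite Rabs_pos_eq; lra. }
apply is_lim_seq_spec in Hl. destruct (Hl eps) as [N HN]. exists N.
intros n Hn. specialize (HN n Hn). rewrite Rminus_0_r in HN.
change (Cmod (u n - l) < eps)%R.
eapply Rle_lt_trans; [apply Hu|]. eapply Rle_lt_trans; [apply Rle_abs|exact HN].
Qed.

Lemma filterlim_Cmult (u v : nat -> C) (lu lv : C) :
  filterlim u eventually (locally lu) -> filterlim v eventually (locally lv) ->
  filterlim (fun n => u n * v n) eventually (locally (lu * lv)).
Proof.
intros Hu Hv P HP. 
(* [filterlim_mult] speaks of neighbourhoods in [C_AbsRing], the goal of those in the product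
   structure on C; [locally_C] identifies the two. *)
apply locally_C in HP.
refine (filterlim_comp_2 (F := eventually)
  (G := locally (T := AbsRing_UniformSpace C_AbsRing) lu)
  (H := locally (T := AbsRing_UniformSpace C_AbsRing) lv) u v _ _ _
  (filterlim_mult (K := C_AbsRing) lu lv) P HP);
  intros Q HQ; [apply Hu|apply Hv]; apply locally_C; exact HQ.
Qed.

Lemma power_sum_correct (c : nat -> C) (z : C) :
  bounded_coef c -> (Cmod z < 1)%R ->
  is_series (fun m => c m * z ^ m) (power_sum c z).
Proof.
intros [B HB] Hz.
assert (He : ex_series (V := C_CompleteNormedModule) (fun m => c m * z ^ m)).
{ apply ex_series_le with (fun m : nat => scal B (Cmod z ^ m)%R).
  - intros m. change (norm ?w) with (Cmod w). change (scal ?u ?v) with (u * v)%R.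
    rewrite Cmod_mult, Cmod_pow. apply Rmult_le_compat_r; [|apply HB].
    apply pow_le, Cmod_ge_0.
  - apply (ex_series_scal (V := R_NormedModule)), ex_series_geom.
    rewrite Rabs_pos_eq; [lra|apply Cmod_ge_0]. }
destruct He as [l Hl].
apply (iota_correct (V := C_CompleteNormedModule)
  (fun l => is_series (V := C_CompleteNormedModule) (fun m => c m * z ^ m) l)).
exists l. split; [exact Hl|].
intros l'. apply is_series_C_unique. exact Hl.
Qed.

(** Partial sums are dominated by a geometric sum of ratio [r], and the bound passes to the limit.
    Its uniformity in [z] later gives bounds uniform in [j] at the points [x ^ j], all of modulus at
    most [Cmod x]. *)
Lemma power_sum_bounded (c : nat -> C) (r : R) :
  bounded_coef c -> (0 <= r < 1)%R ->
  exists M, forall z, (Cmod z <= r)%R -> (Cmod (power_sum c z) <= M)%R.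
Proof.
intros [B HB] Hr. exists (B / (1 - r))%R. intros z Hz.
assert (HB0 : (0 <= B)%R).
{ eapply Rle_trans; [apply Cmod_ge_0|apply (HB 0%nat)]. }
assert (Hs := power_sum_correct c z (ex_intro _ B HB) ltac:(lra)).
assert (Hn := filterlim_comp _ _ _ _ _ _ _ _ Hs
                (filterlim_norm (V := C_NormedModule) _)).
refine (is_lim_seq_le _ _ (Finite _) (Finite (B / (1 - r))) _ Hn
          (is_lim_seq_const _)).
intros n. change (norm ?w) with (Cmod w).
assert (Hp : (Cmod (sum_n (fun m => (c m * z ^ m)%C) n)
              <= B * ((1 - r ^ S n) / (1 - r)))%R).
{ induction n as [|n IH].
  - rewrite sum_O, Cmult_1_r. simpl.
    replace (B * ((1 - r * 1) / (1 - r)))%R with B by (field; lra). apply HB.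
  - rewrite sum_Sn. eapply Rle_trans; [apply Cmod_triangle|].
    replace (B * ((1 - r ^ S (S n)) / (1 - r)))%R
      with (B * ((1 - r ^ S n) / (1 - r)) + B * r ^ S n)%R
      by (simpl; field; lra).
    apply Rplus_le_compat; [exact IH|].
    rewrite Cmod_mult, Cmod_pow.
    apply Rmult_le_compat; [apply Cmod_ge_0|apply pow_le, Cmod_ge_0|apply HB|].
    apply pow_incr. split; [apply Cmod_ge_0|exact Hz]. }
eapply Rle_trans; [exact Hp|]. unfold Rdiv.
apply Rmult_le_compat_l; [exact HB0|].
rewrite <- (Rmult_1_l (/ (1 - r))) at 2.
apply Rmult_le_compat_r; [left; apply Rinv_0_lt_compat; lra|].
assert (H2 := pow_le r (S n) (proj1 Hr)). lra.
Qed.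

(** * Nonvanishing and lower bounds for shifted factorials *)

Lemma Cmod_pow_le (x : C) (n : nat) :
  (Cmod x < 1)%R -> (1 <= n)%nat -> (Cmod (x ^ n) <= Cmod x)%R.
Proof.
intros Hx Hn. destruct n as [|n]; [lia|].
rewrite Cmod_pow. simpl. assert (H := Cmod_ge_0 x).
rewrite <- (Rmult_1_r (Cmod x)) at 3. apply Rmult_le_compat_l; [exact H|].
rewrite <- (pow1 n). apply pow_incr. lra.
Qed.

Lemma Cmod_one_minus (z : C) : (1 - Cmod z <= Cmod (1 - z))%R.
Proof.
assert (H := Cmod_triangle (1 - z) z).
replace (1 - z + z) with (RtoC 1) in H by ring. rewrite Cmod_1 in H. lra.
Qed.

Lemma one_minus_neq_0 (z : C) : (Cmod z < 1)%R -> 1 - z <> 0.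
Proof.
intros Hz H0. assert (H := Cmod_one_minus z). rewrite H0, Cmod_0 in H. lra.
Qed.

Lemma Cmod_mult_pow_le (a x : C) (n : nat) :
  (Cmod a < 1)%R -> (Cmod x < 1)%R -> (Cmod (a * x ^ n) <= Cmod a)%R.
Proof.
intros Ha Hx. rewrite Cmod_mult, Cmod_pow.
rewrite <- (Rmult_1_r (Cmod a)) at 2.
apply Rmult_le_compat_l; [apply Cmod_ge_0|].
rewrite <- (pow1 n). apply pow_incr. split; [apply Cmod_ge_0|lra].
Qed.

Lemma qpoch_neq_0 (a x : C) (n : nat) :
  (Cmod a < 1)%R -> (Cmod x < 1)%R -> qpoch a x n <> 0.
Proof.
intros Ha Hx. induction n as [|n IH]; simpl.
- exact C1_nz.
- apply Cmult_neq_0; [exact IH|]. apply one_minus_neq_0.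
  eapply Rle_lt_trans; [apply Cmod_mult_pow_le; assumption|exact Ha].
Qed.

(** With r = |x|, each factor satisfies |1 - x^(i+1)| >= 1 - r^(i+1) >= exp(-r^(i+1)/(1-r)), and the
    exponents form a convergent geometric series. *)
Lemma qpoch_lower_bound (x : C) :
  (Cmod x < 1)%R ->
  exists d, (0 < d)%R /\ forall n, (d <= Cmod (qpoch x x n))%R.
Proof.
intros Hx. assert (H1 := Cmod_ge_0 x). set (r := Cmod x) in *.
exists (exp (- (r / (1 - r) * (1 / (1 - r))))). split; [apply exp_pos|].
intros n.
apply Rle_trans with
  (exp (- (r / (1 - r) * ((1 - r ^ n) / (1 - r))))).
{ destruct (Rle_lt_or_eq_dec
    (- (r / (1 - r) * (1 / (1 - r))))%R
    (- (r / (1 - r) * ((1 - r ^ n) / (1 - r))))%R) as [H|H].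
  - apply Ropp_le_contravar, Rmult_le_compat_l.
    + apply Rdiv_le_0_compat; lra.
    + apply Rmult_le_compat_r; [left; apply Rinv_0_lt_compat; lra|].
      assert (H2 := pow_le r n H1). lra.
  - left. apply exp_increasing, H.
  - rewrite H. apply Rle_refl. }
induction n as [|n IH]; simpl qpoch.
- rewrite Cmod_1. simpl.
  replace (- (r / (1 - r) * ((1 - 1) / (1 - r))))%R with 0%R by (field; lra).
  rewrite exp_0. lra.
- rewrite Cmod_mult.
  replace (- (r / (1 - r) * ((1 - r ^ S n) / (1 - r))))%R
    with (- (r / (1 - r) * ((1 - r ^ n) / (1 - r)))
          + - (r / (1 - r) * r ^ n))%R by (simpl; field; lra).
  rewrite exp_plus.
  apply Rmult_le_compat; [left; apply exp_pos|left; apply exp_pos|exact IH|].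
  eapply Rle_trans; [|apply Cmod_one_minus].
  rewrite Cmod_mult, Cmod_pow. fold r.
  assert (Hp := pow_le r n H1).
  assert (Hp1 : (r ^ n <= 1)%R) by (rewrite <- (pow1 n); apply pow_incr; lra).
  assert (Hrp : (0 <= r * r ^ n <= r)%R).
  { split; [apply Rmult_le_pos; assumption|].
    rewrite <- (Rmult_1_r r) at 3. apply Rmult_le_compat_l; lra. }
  (* [exp (-s) <= 1 / (1 + s)] with [s = r^(n+1) / (1 - r)] *)
  rewrite exp_Ropp.
  set (s := (r / (1 - r) * r ^ n)%R).
  assert (Hs : (s = r * r ^ n / (1 - r))%R) by (unfold s; field; lra).
  assert (Hs0 : (0 <= s)%R) by (rewrite Hs; apply Rdiv_le_0_compat; lra).
  assert (He := exp_ineq1_le s).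
  apply Rle_trans with (/ (1 + s))%R; [apply Rinv_le_contravar; lra|].
  apply Rmult_le_reg_r with (1 + s)%R; [lra|].
  rewrite Rinv_l by lra.
  (* With t = r^(n+1) and s = t/(1-r), the product (1-t)(1+s) exceeds 1 by t(r-t)/(1-r), which is
     nonnegative because t <= r. *)
  replace ((1 - r * r ^ n) * (1 + s))%R
    with (1 + (r * r ^ n) * (r - r * r ^ n) / (1 - r))%R
    by (rewrite Hs; field; lra).
  assert (0 <= (r * r ^ n) * (r - r * r ^ n) / (1 - r))%R; [|lra].
  apply Rdiv_le_0_compat; [apply Rmult_le_pos|]; lra.
Qed.

(** Nonzero partial products could still tend to 0; the uniform lower bound excludes this. *)
Lemma qpoch_inf_neq_0 (x : C) : (Cmod x < 1)%R -> qpoch_inf x x <> 0.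
Proof.
intros Hx H0. destruct (qpoch_lower_bound x Hx) as [d [Hd Hl]].
assert (H := qpoch_inf_correct x x Hx). rewrite H0 in H.
assert (Hn := proj1 (filterlim_locally_ball_norm (U := C_NormedModule) _ _) H
          (mkposreal d Hd)).
destruct Hn as [N HN]. specialize (HN N (Nat.le_refl N)).
change (Cmod (qpoch x x N - 0) < d)%R in HN.
replace (qpoch x x N - 0) with (qpoch x x N) in HN by ring.
specialize (Hl N). lra.
Qed.

(** * The sums A_j and F_(k,j): convergence and bounds *)

Definition coefA (a x : C) (m : nat) : C := qpoch a x m / qpoch x x m.
(** The extra denominator is what remains of the Gaussian binomial: for n = k + m, (x;x)_(n-1) /
    (x;x)_n = 1 / (1 - x^(k+m)). *)
Definition coefF (a x : C) (k m : nat) : C :=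
  qpoch a x m / (qpoch x x m * (1 - x ^ (k + m))).

Definition sumA (a x : C) (j : nat) : C := power_sum (coefA a x) (x ^ j).
Definition sumF (a x : C) (k j : nat) : C := power_sum (coefF a x k) (x ^ j).

Lemma bounded_coefA (a x : C) : (Cmod x < 1)%R -> bounded_coef (coefA a x).
Proof.
intros Hx. destruct (qpoch_lower_bound x Hx) as [d [Hd Hl]].
exists (exp (Cmod a / (1 - Cmod x)) * / d)%R. intros m. unfold coefA, Cdiv.
rewrite Cmod_mult, Cmod_inv by (apply qpoch_neq_0; assumption).
apply Rmult_le_compat; [apply Cmod_ge_0| |apply qpoch_bound, Hx|].
- left. apply Rinv_0_lt_compat. specialize (Hl m). lra.
- apply Rinv_le_contravar; [exact Hd|apply Hl].
Qed.

Lemma one_minus_pow_neq_0 (x : C) (n : nat) :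
  (Cmod x < 1)%R -> (1 <= n)%nat -> 1 - x ^ n <> 0.
Proof.
intros Hx Hn. apply one_minus_neq_0.
eapply Rle_lt_trans; [apply Cmod_pow_le; assumption|exact Hx].
Qed.

Lemma bounded_coefF (a x : C) (k : nat) :
  (Cmod x < 1)%R -> (1 <= k)%nat -> bounded_coef (coefF a x k).
Proof.
intros Hx Hk. destruct (bounded_coefA a x Hx) as [B HB].
exists (B * / (1 - Cmod x))%R. intros m.
assert (Hn := one_minus_pow_neq_0 x (k + m) Hx ltac:(lia)).
assert (Hq := qpoch_neq_0 x x m Hx Hx).
replace (coefF a x k m) with (coefA a x m * / (1 - x ^ (k + m)))
  by (unfold coefA, coefF; field; split; assumption).
rewrite Cmod_mult, Cmod_inv by exact Hn.
assert (Hl := Cmod_one_minus (x ^ (k + m))).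
assert (Hu := Cmod_pow_le x (k + m) Hx ltac:(lia)).
apply Rmult_le_compat; [apply Cmod_ge_0| |apply HB|].
- left. apply Rinv_0_lt_compat. lra.
- apply Rinv_le_contravar; lra.
Qed.

Lemma sumA_correct (a x : C) (j : nat) :
  (Cmod x < 1)%R -> (1 <= j)%nat ->
  is_series (fun m => coefA a x m * (x ^ j) ^ m) (sumA a x j).
Proof.
intros Hx Hj. apply power_sum_correct; [apply bounded_coefA, Hx|].
eapply Rle_lt_trans; [apply Cmod_pow_le|]; assumption.
Qed.

Lemma sumF_correct (a x : C) (k j : nat) :
  (Cmod x < 1)%R -> (1 <= k)%nat -> (1 <= j)%nat ->
  is_series (fun m => coefF a x k m * (x ^ j) ^ m) (sumF a x k j).
Proof.
intros Hx Hk Hj. apply power_sum_correct; [apply bounded_coefF; assumption|].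
eapply Rle_lt_trans; [apply Cmod_pow_le|]; assumption.
Qed.

Lemma sumA_bounded (a x : C) :
  (Cmod x < 1)%R ->
  exists M, forall j, (1 <= j)%nat -> (Cmod (sumA a x j) <= M)%R.
Proof.
intros Hx.
destruct (power_sum_bounded (coefA a x) (Cmod x)) as [M HM].
- apply bounded_coefA, Hx.
- split; [apply Cmod_ge_0|exact Hx].
- exists M. intros j Hj. apply HM, Cmod_pow_le; assumption.
Qed.

Lemma sumF_bounded (a x : C) (k : nat) :
  (Cmod x < 1)%R -> (1 <= k)%nat ->
  exists M, forall j, (1 <= j)%nat -> (Cmod (sumF a x k j) <= M)%R.
Proof.
intros Hx Hk.
destruct (power_sum_bounded (coefF a x k) (Cmod x)) as [M HM].
- apply bounded_coefF; assumption.
- split; [apply Cmod_ge_0|exact Hx].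
- exists M. intros j Hj. apply HM, Cmod_pow_le; assumption.
Qed.

(** * Recurrences for the sums and the q-binomial theorem *)

(** Raising [j] by one multiplies the m-th term by x^m, so the difference carries the factor 1 -
    x^(k+m), which cancels the denominator of [coefF]. *)
Lemma sumF_step (a x : C) (k j : nat) :
  (Cmod x < 1)%R -> (1 <= k)%nat -> (1 <= j)%nat ->
  sumA a x j = sumF a x k j - x ^ k * sumF a x k (S j).
Proof.
intros Hx Hk Hj.
apply is_series_C_unique with (fun m => coefA a x m * (x ^ j) ^ m);
  [apply sumA_correct; assumption|].
replace (sumF a x k j - x ^ k * sumF a x k (S j))
  with (sumF a x k j + - x ^ k * sumF a x k (S j)) by ring.
apply is_series_ext with
  (fun m => plus (coefF a x k m * (x ^ j) ^ m : C)
              (scal (- x ^ k : C) (coefF a x k m * (x ^ S j) ^ m : C))).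
- intros m. change (coefF a x k m * (x ^ j) ^ m
    + (- x ^ k) * (coefF a x k m * (x ^ S j) ^ m) = coefA a x m * (x ^ j) ^ m).
  assert (Hn := one_minus_pow_neq_0 x (k + m) Hx ltac:(lia)).
  assert (Hq := qpoch_neq_0 x x m Hx Hx).
  unfold coefF, coefA. rewrite Cpow_S, Cpow_mult_l.
  rewrite Cpow_add_r in *. field. split; assumption.
- apply (is_series_plus (V := C_NormedModule));
    [apply sumF_correct; assumption|].
  apply (is_series_scal (V := C_NormedModule)), sumF_correct; auto.
Qed.

(** Split off the term m = 0; the coefficient of index m + 1 is (1 - a x^m) times
    [coefF a x 1 m]. *)
Lemma sumA_shift (a x : C) (j : nat) :
  (Cmod x < 1)%R -> (1 <= j)%nat ->
  sumA a x j = 1 + x ^ j * (sumF a x 1 j - a * sumF a x 1 (S j)).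
Proof.
intros Hx Hj.
apply is_series_C_unique with (fun m => coefA a x m * (x ^ j) ^ m);
  [apply sumA_correct; assumption|].
apply (is_series_decr_1 (V := C_NormedModule)).
replace (plus _ _) with
  (x ^ j * sumF a x 1 j + (- (a * x ^ j)) * sumF a x 1 (S j)).
2:{ change (x ^ j * sumF a x 1 j + (- (a * x ^ j)) * sumF a x 1 (S j)
      = 1 + x ^ j * (sumF a x 1 j - a * sumF a x 1 (S j))
        + - (coefA a x 0 * (x ^ j) ^ 0)).
    unfold coefA. simpl. field. }
apply is_series_ext with
  (fun m => plus (scal (x ^ j : C) (coefF a x 1 m * (x ^ j) ^ m : C))
              (scal (- (a * x ^ j) : C) (coefF a x 1 m * (x ^ S j) ^ m : C))).
- intros m. change (x ^ j * (coefF a x 1 m * (x ^ j) ^ m)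
    + (- (a * x ^ j)) * (coefF a x 1 m * (x ^ S j) ^ m)
    = coefA a x (S m) * (x ^ j) ^ S m).
  assert (Hn := one_minus_pow_neq_0 x (1 + m) Hx ltac:(lia)).
  assert (Hq := qpoch_neq_0 x x m Hx Hx).
  unfold coefF, coefA. simpl qpoch. rewrite !Cpow_S, !Cpow_mult_l.
  simpl Nat.add in *. rewrite Cpow_S in *. field. split; assumption.
- apply (is_series_plus (V := C_NormedModule));
    apply (is_series_scal (V := C_NormedModule)), sumF_correct; auto.
Qed.

Lemma sumA_step (a x : C) (j : nat) :
  (Cmod x < 1)%R -> (1 <= j)%nat ->
  (1 - x ^ j) * sumA a x j = (1 - a * x ^ j) * sumA a x (S j).
Proof.
intros Hx Hj.
assert (H1 := sumF_step a x 1 j Hx (le_n _) Hj).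
assert (H2 := sumF_step a x 1 (S j) Hx (le_n _) ltac:(lia)).
assert (H3 := sumA_shift a x j Hx Hj).
assert (H4 := sumA_shift a x (S j) Hx ltac:(lia)).
rewrite Cpow_1_r in *. rewrite Cpow_S in H4.
transitivity (sumA a x j - x ^ j * sumA a x j); [ring|].
(* Both sides reduce to 1 + (x - a) x^j F_(1,j+1): one copy of each A is expanded by [sumA_shift],
   the other by [sumF_step]. *)
rewrite H3 at 1. rewrite H1.
transitivity (sumA a x (S j) - a * x ^ j * sumA a x (S j)); [|ring].
rewrite H4 at 1. rewrite H2. ring.
Qed.

Lemma sumA_lim (a x : C) :
  (Cmod x < 1)%R ->
  filterlim (fun j => sumA a x (S j)) eventually (locally (1 : C)).
Proof.
intros Hx. assert (H0 := Cmod_ge_0 x).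
destruct (sumF_bounded a x 1 Hx (le_n _)) as [M HM].
apply is_lim_C_geom with (Cmod x * (M + Cmod a * M))%R (Cmod x); [lra|].
intros j. rewrite sumA_shift by (assumption || lia).
replace (1 + x ^ S j * (sumF a x 1 (S j) - a * sumF a x 1 (S (S j))) - 1)
  with (x ^ S j * (sumF a x 1 (S j) - a * sumF a x 1 (S (S j)))) by ring.
rewrite Cmod_mult, Cmod_pow. simpl pow.
replace (Cmod x * (M + Cmod a * M) * Cmod x ^ j)%R
  with (Cmod x * Cmod x ^ j * (M + Cmod a * M))%R by ring.
apply Rmult_le_compat_l.
- apply Rmult_le_pos; [exact H0|apply pow_le, H0].
- eapply Rle_trans; [apply Cmod_triangle|].
  rewrite Cmod_opp, Cmod_mult.
  apply Rplus_le_compat; [apply HM; lia|].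
  apply Rmult_le_compat_l; [apply Cmod_ge_0|apply HM; lia].
Qed.

(** This is the q-binomial theorem at the argument x^(j+1), kept multiplied by (a;x)_(j+1) since
    that factor may vanish for general [a]. *)
Lemma sumA_value (a x : C) (j : nat) :
  (Cmod x < 1)%R ->
  qpoch a x (S j) * sumA a x (S j)
  = qpoch_inf a x / qpoch_inf x x * qpoch x x j.
Proof.
intros Hx. assert (Hq := fun n => qpoch_neq_0 x x n Hx Hx).
set (c := qpoch a x 1 * sumA a x 1).
assert (Hc : forall n, qpoch a x (S n) * sumA a x (S n) = c * qpoch x x n).
{ induction n as [|n IH]; [unfold c; simpl; ring|].
  change (qpoch a x (S (S n))) with (qpoch a x (S n) * (1 - a * x ^ S n)).
  transitivity (qpoch a x (S n) * ((1 - a * x ^ S n) * sumA a x (S (S n))));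
    [ring|].
  rewrite <- sumA_step by (assumption || lia).
  transitivity (qpoch a x (S n) * sumA a x (S n) * (1 - x ^ S n)); [ring|].
  rewrite IH. simpl. ring. }
(* Letting n tend to infinity in [Hc] identifies the constant, since A_(n+1) tends to 1. *)
assert (Hlim : c * qpoch_inf x x = qpoch_inf a x).
{ apply (filterlim_locally_unique (V := C_NormedModule) (F := eventually)
           (fun n => c * qpoch x x n)).
  - refine (filterlim_comp _ _ _ _ (fun z : C => scal c z) _ _ _
      (qpoch_inf_correct x x Hx)
      (filterlim_scal_r (V := C_NormedModule) c (qpoch_inf x x))).
  - apply filterlim_ext with (fun n => qpoch a x (S n) * sumA a x (S n));
      [exact Hc|].
    rewrite <- (Cmult_1_r (qpoch_inf a x)).
    apply filterlim_Cmult; [|apply sumA_lim, Hx].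
    refine (filterlim_comp _ _ _ S (qpoch a x) _ _ _ _ (qpoch_inf_correct a x Hx)).
    apply eventually_subseq. intros n. lia. }
rewrite Hc, <- Hlim. field. apply qpoch_inf_neq_0, Hx.
Qed.

(** * The contiguous relation between F_(k,k+1) and F_(k+1,k+2) *)

Lemma const_geom_eq_0 (u : nat -> C) (M r : R) :
  (0 <= r < 1)%R -> (forall n, u (S n) = u n) ->
  (forall n, (Cmod (u n) <= M * r ^ n)%R) -> u 0%nat = 0.
Proof.
intros Hr Hc Hu.
apply (filterlim_locally_unique (V := C_NormedModule) (F := eventually) u).
- apply filterlim_ext with (fun _ => u 0%nat); [|apply filterlim_const].
  induction x as [|n IH]; [reflexivity|]. rewrite Hc. exact IH.
- apply is_lim_C_geom with M r; [exact Hr|].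
  intros n. replace (u n - 0) with (u n) by ring. apply Hu.
Qed.

(** Shift the second index of every sum by [r] and multiply by [(x^k)^r]: the
    difference of the two sides is then independent of [r] and tends to 0. *)
Lemma sumF_contiguous (q : C) (k : nat) :
  (Cmod q < 1)%R -> (1 <= k)%nat ->
  let x := q ^ 2 in
  (1 - x ^ k) * sumF (- q) x k (S k)
  + q ^ 3 * (x ^ k) ^ 2 * (1 + q * x ^ k) * sumF (- q) x (S k) (S (S k))
  = sumA (- q) x (S k) * (1 - x * (x ^ k) ^ 2).
Proof.
intros Hq Hk x.
assert (Hx : (Cmod x < 1)%R).
{ eapply Rle_lt_trans; [apply Cmod_pow_le|]; auto. }
set (K := x ^ k).
assert (HK : (Cmod K < 1)%R).
{ eapply Rle_lt_trans; [apply Cmod_pow_le|]; auto. }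
set (E := fun r : nat =>
  K ^ r * ((1 - K) * sumF (- q) x k (S (k + r))
  + q ^ 3 * K ^ 2 * (1 + q * K) * x ^ r * sumF (- q) x (S k) (S (S (k + r)))
  - sumA (- q) x (S (k + r)) * (1 - x * K ^ 2 * x ^ r))).
assert (HE : E 0%nat = 0).
{ destruct (sumF_bounded (- q) x k Hx Hk) as [M1 HM1].
  destruct (sumF_bounded (- q) x (S k) Hx ltac:(lia)) as [M2 HM2].
  destruct (sumA_bounded (- q) x Hx) as [M3 HM3].
  (* The constant bounds the bracket of [E r] for every [r], using |x^r| <= 1; the decay comes from
     the prefactor [K ^ r]. *)
  apply const_geom_eq_0 with
    (Cmod (1 - K) * M1 + Cmod (q ^ 3 * K ^ 2 * (1 + q * K)) * M2
     + M3 * (1 + Cmod (x * K ^ 2)))%R (Cmod K).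
  - split; [apply Cmod_ge_0|exact HK].
  - intros r. unfold E.
    assert (H1 := sumF_step (- q) x k (S (k + r)) Hx Hk ltac:(lia)).
    assert (H2 := sumF_step (- q) x (S k) (S (S (k + r))) Hx ltac:(lia) ltac:(lia)).
    assert (H3 := sumA_step (- q) x (S (k + r)) Hx ltac:(lia)).
    replace (k + S r)%nat with (S (k + r)) by lia.
    rewrite (Cpow_S x k), (Cpow_S x (k + r)), (Cpow_add_r x k r) in *.
    fold K in H1, H2, H3.
    set (X := x ^ r) in *.
    set (A0 := sumA _ _ (S (k + r))) in *.
    set (A1 := sumA _ _ (S (S (k + r)))) in *.
    set (F0 := sumF _ _ k (S (k + r))) in *.
    set (F1 := sumF _ _ k (S (S (k + r)))) in *.
    set (G0 := sumF _ _ (S k) (S (S (k + r)))) in *.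
    set (G1 := sumF _ _ (S k) (S (S (S (k + r))))) in *.
    replace F0 with (A0 + K * F1) by (rewrite H1; ring).
    replace G0 with (A1 + x * K * G1) by (rewrite H2; ring).
    (* The added term vanishes by [H3]. It is exactly [E (S r) - E r]: the sums F and G cancel, and
       in the coefficient of [A1] the K^2 terms cancel because x^2 = q^4. *)
    transitivity (K ^ r * ((1 - K) * (A0 + K * F1)
      + q ^ 3 * K ^ 2 * (1 + q * K) * X * (A1 + x * K * G1)
      - A0 * (1 - x * K ^ 2 * X))
      + K ^ S r * ((1 - x * (K * X)) * A0 - (1 - - q * (x * (K * X))) * A1)).
    { rewrite !Cpow_S. fold X. unfold x. ring. }
    rewrite H3. ring.
  - intros r. unfold E. rewrite Cmod_mult, Cmod_pow.
    rewrite Rmult_comm. apply Rmult_le_compat_r; [apply pow_le, Cmod_ge_0|].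
    assert (Hxr : (Cmod (x ^ r) <= 1)%R).
    { rewrite Cmod_pow, <- (pow1 r). apply pow_incr.
      split; [apply Cmod_ge_0|lra]. }
    unfold Cminus at 1.
    eapply Rle_trans; [apply Cmod_triangle|]. rewrite Cmod_opp.
    apply Rplus_le_compat;
      [eapply Rle_trans; [apply Cmod_triangle|]; apply Rplus_le_compat|].
    + rewrite Cmod_mult.
      apply Rmult_le_compat_l; [apply Cmod_ge_0|apply HM1; lia].
    + rewrite Cmod_mult.
      apply Rmult_le_compat; [apply Cmod_ge_0..| |apply HM2; lia].
      rewrite Cmod_mult, <- Rmult_1_r.
      apply Rmult_le_compat_l; [apply Cmod_ge_0|exact Hxr].
    + rewrite Cmod_mult.
      apply Rmult_le_compat; [apply Cmod_ge_0..|apply HM3; lia|].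
      eapply Rle_trans; [apply Cmod_triangle|].
      rewrite Cmod_1, Cmod_opp, Cmod_mult. apply Rplus_le_compat_l.
      rewrite <- Rmult_1_r.
      apply Rmult_le_compat_l; [apply Cmod_ge_0|exact Hxr]. }
unfold E in HE. rewrite Nat.add_0_r in HE. rewrite !Cmult_1_l, !Cmult_1_r in HE.
match goal with |- ?L = ?R => replace L with (L - R + R) by ring end.
rewrite HE. ring.
Qed.

(** Adding q^3 times [sumF_step] to [sumA_shift], both at j = 2, eliminates F_(1,3), since q^3 x = q
    x^2. This is the input for k = 1. *)
Lemma sumF_1_2 (q : C) :
  (Cmod q < 1)%R ->
  let x := q ^ 2 in
  q ^ 3 * (1 + q) * sumF (- q) x 1 2 = sumA (- q) x 2 * (1 + q ^ 3) - 1.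
Proof.
intros Hq x.
assert (Hx : (Cmod x < 1)%R).
{ eapply Rle_lt_trans; [apply Cmod_pow_le|]; auto. }
assert (H1 := sumF_step (- q) x 1 2 Hx (le_n _) ltac:(lia)).
assert (H2 := sumA_shift (- q) x 2 Hx ltac:(lia)).
rewrite Cpow_1_r in H1.
transitivity (sumA (- q) x 2 + q ^ 3 * sumA (- q) x 2 - 1); [|ring].
rewrite H2 at 1. rewrite H1. unfold x. ring.
Qed.

(** * The series of the theorem and its recurrence in k *)

(** [seriesS q p] is the value of the series of the theorem for [k = p + 1]. *)
Definition seriesS (q : C) (p : nat) : C :=
  qpoch (- q) (q ^ 2) (S p) * q ^ (S p * (2 * S p + 1)) / qpoch (q ^ 2) (q ^ 2) p
  * sumF (- q) (q ^ 2) (S p) (S (S p)).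

Lemma seriesS_correct (q : C) (p : nat) :
  (Cmod q < 1)%R ->
  is_series
    (fun m : nat =>
       let n := (S p + m)%nat in
       qpoch (- q) (q ^ 2) (S p) * qpoch (- q) (q ^ 2) (n - S p)
       * q ^ (2 * (S p + 1) * n - S p)
       / qpoch (q ^ 2) (q ^ 2) n
       * qbinom (q ^ 2) (n - 1) (S p - 1)) (seriesS q p).
Proof.
intros Hq. set (x := q ^ 2).
assert (Hx : (Cmod x < 1)%R).
{ eapply Rle_lt_trans; [apply Cmod_pow_le|]; auto. }
apply is_series_ext with
  (fun m => scal (qpoch (- q) x (S p) * q ^ (S p * (2 * S p + 1)) / qpoch x x p : C)
     (coefF (- q) x (S p) m * (x ^ S (S p)) ^ m : C)).
- intros m. cbv zeta.
  change (qpoch (- q) x (S p) * q ^ (S p * (2 * S p + 1)) / qpoch x x p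
     * (coefF (- q) x (S p) m * (x ^ S (S p)) ^ m) =
    qpoch (- q) x (S p) * qpoch (- q) x (S p + m - S p)
    * q ^ (2 * (S p + 1) * (S p + m) - S p)
    / qpoch x x (S p + m) * qbinom x (S p + m - 1) (S p - 1)).
  replace (S p + m - S p)%nat with m by lia.
  replace (S p + m - 1)%nat with (p + m)%nat by lia.
  replace (S p - 1)%nat with p by lia.
  (* With k = p + 1 the exponent is k(2k+1) + 2(k+1)m: the first part joins the constant prefactor,
     the second gives the power of x^(k+1). *)
  replace (2 * (S p + 1) * (S p + m) - S p)%nat
    with (S p * (2 * S p + 1) + 2 * (S (S p) * m))%nat by nia.
  rewrite Cpow_add_r, (Cpow_mult_r q 2). fold x.
  rewrite (Cpow_mult_r x (S (S p)) m).
  unfold qbinom, coefF. replace (p + m - p)%nat with m by lia.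
  change (qpoch x x (S p + m)) with (qpoch x x (p + m) * (1 - x * x ^ (p + m))).
  change (x ^ (S p + m)) with (x * x ^ (p + m)).
  assert (Hn := one_minus_pow_neq_0 x (S (p + m)) Hx ltac:(lia)).
  rewrite Cpow_S in Hn.
  assert (Hqp := fun n => qpoch_neq_0 x x n Hx Hx).
  field. repeat split; auto.
- apply (is_series_scal (V := C_NormedModule)), sumF_correct; auto with arith.
Qed.

Lemma seriesS_0 (q : C) :
  (Cmod q < 1)%R ->
  qpoch_inf (- q) (q ^ 2) / qpoch_inf (q ^ 2) (q ^ 2) * (1 - q) = 1 + seriesS q 0.
Proof.
intros Hq.
assert (Hx : (Cmod (q ^ 2) < 1)%R).
{ eapply Rle_lt_trans; [apply Cmod_pow_le|]; auto. }
assert (HA := sumA_value (- q) (q ^ 2) 1 Hx).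
assert (HF := sumF_1_2 q Hq). cbv zeta in HF.
unfold seriesS.
set (P := qpoch_inf (- q) (q ^ 2) / qpoch_inf (q ^ 2) (q ^ 2)) in *.
set (A := sumA _ _ _) in *. set (F := sumF _ _ _ _) in *.
simpl qpoch in *.
assert (Hq1 : 1 + q <> 0).
{ replace (1 + q) with (1 - - q) by ring. apply one_minus_neq_0.
  rewrite Cmod_opp. exact Hq. }
transitivity (1 + q ^ 3 * (1 + q) * F); [|simpl; field].
rewrite HF.
(* Here (-q;q^2)_2 = (1+q)(1+q^3) and (q^2;q^2)_1 = (1-q)(1+q), so the common factor 1 + q can be
   cancelled. *)
assert (HA1 : A * (1 + q ^ 3) * (1 + q) = P * (1 - q) * (1 + q)).
{ etransitivity; [etransitivity; [|exact HA]|]; simpl; ring. }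
replace (1 + (A * (1 + q ^ 3) - 1)) with (A * (1 + q ^ 3) * (1 + q) / (1 + q))
  by (field; exact Hq1).
rewrite HA1. field. exact Hq1.
Qed.

Lemma seriesS_step (q : C) (p : nat) :
  (Cmod q < 1)%R ->
  seriesS q p + seriesS q (S p)
  = qpoch_inf (- q) (q ^ 2) / qpoch_inf (q ^ 2) (q ^ 2)
    * (q ^ (S p * (2 * S p + 1)) * (1 - q ^ (2 * S p + 1))).
Proof.
intros Hq.
assert (Hx : (Cmod (q ^ 2) < 1)%R).
{ eapply Rle_lt_trans; [apply Cmod_pow_le|]; auto. }
assert (HA := sumA_value (- q) (q ^ 2) (S p) Hx).
assert (HF := sumF_contiguous q (S p) Hq ltac:(lia)). cbv zeta in HF.
unfold seriesS.
set (P := qpoch_inf (- q) (q ^ 2) / qpoch_inf (q ^ 2) (q ^ 2)) in *.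
set (A := sumA _ _ _) in *.
set (F1 := sumF _ _ (S p) _) in *. set (F2 := sumF _ _ (S (S p)) _) in *.
replace (S (S p) * (2 * S (S p) + 1))%nat
  with (S p * (2 * S p + 1) + (3 + 2 * S p + 2 * S p))%nat by lia.
replace (2 * S p + 1)%nat with (1 + 2 * S p)%nat by lia.
rewrite !Cpow_add_r, !(Cpow_mult_r q 2), Cpow_1_r.
change (qpoch (- q) (q ^ 2) (S (S p)))
  with (qpoch (- q) (q ^ 2) (S p) * (1 - - q * (q ^ 2) ^ S p)) in *.
change (qpoch (q ^ 2) (q ^ 2) (S p))
  with (qpoch (q ^ 2) (q ^ 2) p * (1 - (q ^ 2) ^ S p)) in *.
assert (H1 := one_minus_pow_neq_0 (q ^ 2) (S p) Hx ltac:(lia)).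
assert (H2 := qpoch_neq_0 (q ^ 2) (q ^ 2) p Hx Hx).
set (K := (q ^ 2) ^ S p) in *.
set (Y := q ^ (S p * (1 + 2 * S p))) in *.
set (D := qpoch (q ^ 2) (q ^ 2) p) in *.
set (N := qpoch (- q) (q ^ 2) (S p)) in *.
(* The prefactor of [seriesS q (S p)] is that of [seriesS q p] times q^3 K^2 (1 + qK) / (1 - K), so
   the sum becomes a multiple of the left side of the contiguous relation. *)
transitivity (N * Y / (D * (1 - K)) *
  ((1 - K) * F1 + q ^ 3 * K ^ 2 * (1 + q * K) * F2)).
{ field. split; assumption. }
rewrite HF.
(* Since 1 - q^2 K^2 = (1 + qK)(1 - qK), the factor 1 + qK completes the shifted factorial required
   by [sumA_value], and 1 - qK is 1 - q^(2k+1) with k = p + 1. *)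
transitivity (N * (1 - - q * K) * A * Y * (1 - q * K) / (D * (1 - K))).
{ field. split; assumption. }
rewrite HA. field. split; assumption.
Qed.

Theorem theorem1p3 :
  forall (q : C) (k : nat),
    (Cmod q < 1)%R -> (1 <= k)%nat ->
    exists S : C,
      is_series
        (fun m : nat =>
           let n := (k + m)%nat in
           qpoch (- q) (q ^ 2) k * qpoch (- q) (q ^ 2) (n - k)
           * q ^ (2 * (k + 1) * n - k)
           / qpoch (q ^ 2) (q ^ 2) n
           * qbinom (q ^ 2) (n - 1) (k - 1)) S
      /\ qpoch_inf (- q) (q ^ 2) / qpoch_inf (q ^ 2) (q ^ 2)
         * sum_n (fun j : nat =>
                    (-1) ^ j * q ^ (j * (2 * j + 1)) * (1 - q ^ (2 * j + 1)))
                 (k - 1)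
         = 1 + (-1) ^ (k - 1) * S.
Proof.
intros q [|p] Hq Hk; [lia|].
exists (seriesS q p). split; [apply seriesS_correct, Hq|].
replace (S p - 1)%nat with p by lia. clear Hk.
induction p as [|p IH].
- rewrite sum_O. transitivity (1 + seriesS q 0); [|simpl; ring].
  rewrite <- seriesS_0 by exact Hq. simpl. ring.
- rewrite sum_Sn.
  match goal with |- ?P * plus ?s ?t = _ =>
    transitivity (P * s + P * t); [apply Cmult_plus_distr_l|] end.
  rewrite IH.
  (* By [seriesS_step] the new term is (-1)^(p+1) times the sum of two consecutive series values;
     the older value cancels against the induction hypothesis. *)
  transitivity (1 + (-1) ^ p * seriesS q p
    + (-1) ^ S p * (qpoch_inf (- q) (q ^ 2) / qpoch_inf (q ^ 2) (q ^ 2)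
        * (q ^ (S p * (2 * S p + 1)) * (1 - q ^ (2 * S p + 1))))); [ring|].
  rewrite <- seriesS_step by exact Hq. rewrite Cpow_S. ring.
Qed.
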